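(* Let $(X,\|\cdot\|)$ be a normed space and $0<p\leq 1$. Then the following assertions are valid: (i) $F(p;0)=(0,1]\times\cdots\times(0,1]$ ($n$ factors); (ii) $F(p;k)=\varnothing$ for all $k=1,\dots,n$; (iii) $F(p)=F(p;0)$.
   Context: For a normed space $(X,\|\cdot\|)$, a positive integer $n$ and $p>0$, let $F(p)$ be the set of all $n$-tuples $(\mu_1,\dots,\mu_n)\in\mathbb{R}^n$ (with all $\mu_i\neq 0$, so that the fractions make sense) such that $$\left\|\sum_{i=1}^n x_i\right\|^p\leq\sum_{i=1}^n\frac{\|x_i\|^p}{\mu_i}\quad\text{for all } x_1,\dots,x_n\in X.$$ For $k=0,1,\dots,n$, let $F(p;k)$ be the subset of those $(\mu_1,\dots,\mu_n)\in F(p)$ for which exactly $k$ of the numbers $\mu_1,\dots,\mu_n$ are negative.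
   Formalization: The normed space X is assumed to contain a nonzero vector; for X = {0} the inequality is 0 ≤ 0, so F(p) consists of all tuples with nonzero entries and (i), (ii), (iii) all fail. *)

(* Defs.v *)
From mathcomp Require Import all_boot all_order all_algebra.
From mathcomp Require Import all_classical all_reals all_analysis.
Import Order.TTheory GRing.Theory Num.Theory.
Import numFieldNormedType.Exports.

Set Implicit Arguments.
Unset Strict Implicit.
Unset Printing Implicit Defensive.

Local Open Scope classical_set_scope.
Local Open Scope ring_scope.

(* A complex normed space is covered through its underlying real normed space,
   as only the addition and the norm of X occur. Division by zero is total
   here, hence the explicit condition that the components of mu are nonzero. *)
Definition F (R : realType) (X : normedModType R) (n : nat) (p : R) :
    set 'rV[R]_n :=
  [set mu | (forall i : 'I_n, mu ord0 i != 0) /\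
     forall x : 'I_n -> X,
       `| \sum_(i < n) x i | `^ p <= \sum_(i < n) (`| x i | `^ p / mu ord0 i)].

Definition Fk (R : realType) (X : normedModType R) (n : nat) (p : R) (k : nat) :
    set 'rV[R]_n :=
  [set mu | F X p mu /\ #|[pred i : 'I_n | mu ord0 i < 0]| = k].

(* Main.v *)
Require Import Defs.
From mathcomp Require Import all_boot all_order all_algebra.
From mathcomp Require Import all_classical all_reals all_analysis.
Import Order.TTheory GRing.Theory Num.Theory.
Import numFieldNormedType.Exports.

Local Open Scope classical_set_scope.
Local Open Scope ring_scope.

(** Everything follows from the identity [F X p = (0, 1]^n] for [0 < p <= 1]:
    no point of this box has a negative component, so the number of negative
    components is [0] throughout [F X p].

    Testing the defining inequality on a family supported at one index, with a
    nonzero value there, leaves [1 <= 1 / mu_i], which forces [0 < mu_i <= 1]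
    ([F_coord_bounds]). Conversely, if [0 < mu_i <= 1] then each weight
    [1 / mu_i] is at least [1], and it suffices to know that [x |-> `|x| `^ p]
    is subadditive ([powR_norm_sum]). That is the triangle inequality followed
    by subadditivity of [t |-> t `^ p] on the nonnegative reals
    ([powR_subadditive]). *)

(** Geometrically, the segment from the origin to the point of the graph above
    [s] stays below the graph: the ratio [c / s] is at most [1], so raising it
    to the power [p <= 1] can only increase it, and powers are
    multiplicative. *)
Lemma powR_ge_chord (R : realType) (p s c : R) :
  p <= 1 -> 0 < s -> 0 <= c <= s -> c / s * s `^ p <= c `^ p.
Proof.
move=> p1 s0 /andP[]; rewrite le_eqVlt => /predU1P[<- _|c0 cs].
  by rewrite !mul0r powR_ge0.
have cs0 : 0 < c / s by rewrite divr_gt0.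
have -> : c `^ p = (c / s) `^ p * s `^ p.
  by rewrite -powRM ?(ltW cs0) ?(ltW s0)// divfK// gt_eqF.
rewrite ler_wpM2r ?powR_ge0// ger1_powR//.
by rewrite cs0 ler_pdivrMr// mul1r.
Qed.

(** Adding the bounds of [powR_ge_chord] at [a] and at [b] for [s = a + b] gives the claim, since [a / (a + b) + b / (a + b) = 1]. *)
Lemma powR_subadditive (R : realType) (p a b : R) :
  p <= 1 -> 0 <= a -> 0 <= b -> (a + b) `^ p <= a `^ p + b `^ p.
Proof.
move=> p1 a0 b0; have : 0 <= a + b by rewrite addr_ge0.
rewrite le_eqVlt => /predU1P[ab0|s0].
  have /andP[/eqP-> /eqP->] : (a == 0) && (b == 0).
    by rewrite -paddr_eq0// -ab0.
  by rewrite addr0 lerDl powR_ge0.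
have -> : (a + b) `^ p = a / (a + b) * (a + b) `^ p + b / (a + b) * (a + b) `^ p.
  by rewrite -mulrDl -mulrDl divff ?mul1r// gt_eqF.
by rewrite lerD// powR_ge_chord// ?a0 ?b0 ?lerDl ?lerDr.
Qed.

Lemma powR_norm_sum (R : realType) (X : normedModType R) (n : nat) (p : R)
    (x : 'I_n -> X) : 0 < p <= 1 ->
  `| \sum_(i < n) x i | `^ p <= \sum_(i < n) `| x i | `^ p.
Proof.
move=> /andP[p0 p1].
elim/big_ind2 : _ => [|a u b v ua vb|//]; first by rewrite normr0 powR0// gt_eqF.
apply: le_trans (lerD ua vb).
apply: le_trans (powR_subadditive _ _ _ _ p1 (normr_ge0 u) (normr_ge0 v)).
by apply: ge0_ler_powR; rewrite ?(ltW p0) ?nnegrE ?addr_ge0 ?ler_normD.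
Qed.

(** Evaluating the inequality at a family whose only nonzero value sits at
    index [i]; such a value exists because [X] is nontrivial. *)
Lemma F_coord_bounds (R : realType) (X : normedModType R) (n : nat) (p : R)
    (mu : 'rV[R]_n) (i : 'I_n) :
  (exists x : X, x != 0) -> 0 < p -> F X p mu -> 0 < mu ord0 i <= 1.
Proof.
move=> [v v0] p0 [mu0 Fmu].
have /= := Fmu (fun j => if j == i then v else 0).
rewrite (bigD1 i)//= eqxx big1 ?addr0; last by move=> j /negbTE->.
rewrite (bigD1 i)//= eqxx big1 ?addr0; last first.
  by move=> j /negbTE->; rewrite normr0 powR0 ?mul0r// gt_eqF.
rewrite ler_pMr ?powR_gt0 ?normr_gt0// => mui.
have mugt0 : 0 < mu ord0 i by rewrite -invr_gt0 (lt_le_trans ltr01).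
by rewrite mugt0 -invf_ge1.
Qed.

Lemma F_box (R : realType) (X : normedModType R) (n : nat) (p : R) :
  (exists x : X, x != 0) -> 0 < p <= 1 ->
  @F R X n p = [set mu : 'rV[R]_n | forall i : 'I_n, 0 < mu ord0 i <= 1].
Proof.
move=> hX hp; have /andP[p0 _] := hp.
apply/seteqP; split=> [mu Fmu i|mu box]; first exact: (F_coord_bounds _ _ _ _ _ _ hX p0).
split=> [i|x]; first by have /andP[mui _] := box i; rewrite gt_eqF.
apply: le_trans (powR_norm_sum _ _ _ _ _ hp) _; apply: ler_sum => i _.
have /andP[mui mui1] := box i.
by rewrite ler_peMr ?powR_ge0// invf_ge1.
Qed.

Theorem theorem2p5 (R : realType) (X : normedModType R) (n : nat) (p : R)
    (hX : exists x : X, x != 0) (hn : (0 < n)%N) (hp : 0 < p <= 1) :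
  [/\ @Fk R X n p 0 = [set mu : 'rV[R]_n | forall i : 'I_n, 0 < mu ord0 i <= 1],
      forall k : nat, (1 <= k <= n)%N -> @Fk R X n p k = set0
    & @F R X n p = @Fk R X n p 0].
Proof.
have noneg (mu : 'rV[R]_n) : F X p mu -> #|[pred i : 'I_n | mu ord0 i < 0]| = 0%N.
  rewrite F_box// => box; apply: eq_card0 => i; rewrite !inE.
  by have /andP[mui _] := box i; rewrite ltNge (ltW mui).
have FFk : @F R X n p = @Fk R X n p 0.
  by apply/seteqP; split=> [mu Fmu|mu []//]; split=> //; exact: noneg.
split=> //; first by rewrite -FFk F_box.
move=> k /andP[k0 _]; apply/seteqP; split=> // mu [Fmu kE].
by move: k0; rewrite -kE noneg.
Qed.
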